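(* There is an absolute constant $C>0$ such that the following holds for every positive integer $n$ and every Sidon set $S=\{a_1<a_2<\cdots<a_t\}\subset\{1,2,\ldots,n\}$ (with $t=|S|$): if $t\geqslant n^{1/2}-n^{1/4}$, then $$\left|\sum_{i=1}^t a_i-\frac{1}{2}nt\right|\leqslant C\, n^{11/8},$$ and if $t<n^{1/2}-n^{1/4}$, then $$\left|\sum_{i=1}^t a_i-\frac{1}{2}nt\right|\leqslant C\, n^{5/4}\sqrt{n^{1/2}-t}.$$
   Context: A set $S\subset\{1,2,\ldots,n\}$ is called a Sidon set if all the sums $a+b$ with $a,b\in S$ are different (up to the order of the summands, i.e. the sums $a+b$ with $a\leqslant b$, $a,b\in S$, are pairwise distinct). *)

(* Defs.v *)
From mathcomp Require Import all_boot all_order.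
From mathcomp Require Import finmap.

Set Implicit Arguments.
Unset Strict Implicit.
Unset Printing Implicit Defensive.

Local Open Scope nat_scope.

Definition sidon (S : {fset nat}) : Prop :=
  forall a b c d : nat, a \in S -> b \in S -> c \in S -> d \in S ->
    a <= b -> c <= d -> a + b = c + d -> a = c /\ b = d.

(* Main.v *)
Require Import Defs.
From mathcomp Require Import all_boot all_order all_algebra finmap.
From mathcomp Require Import all_classical all_reals all_analysis.
From mathcomp Require Import zify ring lra.

Set Implicit Arguments.
Unset Strict Implicit.
Unset Printing Implicit Defensive.

Import Order.TTheory GRing.Theory Num.Theory.
Local Open Scope ring_scope.

(** The sum of a Sidon set is read off from its distribution over short
    windows.  Fix a length [u], put [L = n + u] and let [A m], for [m < L], be
    the number of elements of [S] in the window of length [u] that ends at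
    [m].  Every element lies in exactly [u] windows, so [A] has mean
    [u * t / L] with [t] the cardinal of [S]; moreover the correlation of [A]
    with the position [m], measured from the midpoint [(L - 1) / 2], is exactly
    [u] times the quantity [D] (the sum of [S] minus [n * t / 2]) that has to be
    bounded.

    The Sidon property limits the fluctuation of [A].  The sum of the [A m ^ 2]
    counts triples made of a window and two of its elements; a difference
    [d > 0] is realised by at most one pair of elements, and that pair lies in
    [u - d] windows, so the sum is at most [u ^ 2 + u * t]
    ([sidon_window_square]).  Subtracting the square of the mean gives a
    variance bound, and the Cauchy-Schwarz inequality turns it into
    [4 * u * D ^ 2 <= L ^ 2 * (L * (u + t) - u * t ^ 2)]
    ([sidon_sum_deviation]).

    With [n = r ^ 4], the choice of [u] of order [r ^ 3] balances the two error
    terms [L - n = u] and [L * t / u]; the inequality above first forces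
    [t = O(r ^ 2)], as its right-hand side cannot be negative, and then reads
    [D ^ 2 = O(r ^ 8 * (r ^ 4 - t ^ 2 + r ^ 3))] ([deviation_bound]).  Finally
    [r ^ 4 - t ^ 2 = (r ^ 2 - t) * (r ^ 2 + t)]: this is [O(r ^ 3)] when
    [r ^ 2 - t <= r], while for [r ^ 2 - t > r] the term [r ^ 3] is absorbed by
    [r ^ 2 * (r ^ 2 - t)].  Both regimes follow with the constant [6]. *)

(** * Pairs of a Sidon set in short windows *)

Definition window_count (S : {fset nat}) (u m : nat) : nat :=
  (\sum_(a <- S) (a <= m < a + u))%N.

Lemma sum_interval_indicator (L b c : nat) : (c <= L)%N ->
  (\sum_(0 <= m < L) (b <= m < c) = c - b)%N.
Proof.
move=> cL; suff -> : (\sum_(0 <= m < L) (b <= m < c) = minn L c - b)%N by lia.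
elim: L {cL} => [|L IH]; first by rewrite big_geq // min0n sub0n.
by rewrite big_nat_recr //= IH; case: andP => /=; lia.
Qed.

(** Rewriting [b - a = d - c] as [a + d = b + c] turns a repeated difference
    into a repeated sum. *)
Lemma sidon_diff_inj (S : {fset nat}) (a b c d : nat) : sidon S ->
  a \in S -> b \in S -> c \in S -> d \in S ->
  (a < b)%N -> (c < d)%N -> (b - a = d - c)%N -> a = c /\ b = d.
Proof.
move=> sS aS bS cS dS ab cd e.
have [ad|da] := leqP a d; have [bc|cb] := leqP b c.
- have [] := sS a d b c aS dS bS cS ad bc; lia.
- have [] := sS a d c b aS dS cS bS ad (ltnW cb); lia.
- lia.
- have [] := sS d a c b dS aS cS bS (ltnW da) (ltnW cb); lia.
Qed.

(** A pair [a < b] with [b - a = d] is contained in [u - d] windows, none if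
    [d >= u].  Since each [d] occurs at most once, the total over all pairs is
    at most [(u - 1) + (u - 2) + ... + 1]. *)
Lemma sidon_overlaps (S : {fset nat}) (u : nat) : sidon S ->
  (\sum_(a <- S) \sum_(b <- S | a < b) (a + u - b) <= 'C(u, 2))%N.
Proof.
move=> sS.
pose P := [seq p <- [seq (a, b) | a <- S, b <- S] | p.1 < p.2 < p.1 + u]%N.
have uP : uniq [seq p.2 - p.1 | p <- P]%N.
  rewrite map_inj_in_uniq; last first.
    move=> [a b] [c d]; rewrite !mem_filter /=.
    case/andP=> /andP[ab _] /allpairsP[[a' b'] [/= aS bS [? ?]]]; subst a' b'.
    case/andP=> /andP[cd _] /allpairsP[[c' d'] [/= cS dS [? ?]]] e; subst c' d'.
    by have [-> ->] := sidon_diff_inj sS aS bS cS dS ab cd e.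
  apply: filter_uniq; apply: allpairs_uniq; rewrite ?fset_uniq //.
  by move=> [? ?] [? ?].
have -> : (\sum_(a <- S) \sum_(b <- S | a < b) (a + u - b) =
           \sum_(d <- [seq p.2 - p.1 | p <- P]) (u - d))%N.
  rewrite big_map big_filter [RHS]big_mkcond big_allpairs /=.
  apply: eq_bigr => a _; rewrite big_mkcond /=; apply: eq_bigr => b _.
  by case: ltnP => //= ab; case: ifP; lia.
have -> : ('C(u, 2) = \sum_(d <- iota 1 u) (u - d))%N.
  have := bin2_sum u; rewrite big_nat_rev /= /index_iota subn0 => <-.
  rewrite (iotaDl 1 0) big_map; apply: eq_bigr => i _; lia.
apply: uniq_sub_le_big => //.
- by move=> x y; exact: leq_addr.
- exact: iota_uniq.
move=> d /mapP[[a b]]; rewrite mem_filter mem_iota /= => + ->; lia.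
Qed.

(** Expanding the square and summing over the windows first leaves, for each
    ordered pair [(a, b)], the number of windows containing both; the diagonal
    gives [u * t] and the rest is twice the sum over [a < b]. *)
Lemma sidon_window_square (S : {fset nat}) (n u : nat) : sidon S ->
  (forall a, a \in S -> a <= n)%N ->
  (\sum_(0 <= m < n + u) window_count S u m ^ 2 <= u * (u + #|` S|))%N.
Proof.
move=> sS Sn.
(* The windows containing both a and b end in [max a b, min a b + u). *)
pose w a b := (minn a b + u - maxn a b)%N.
have -> : (\sum_(0 <= m < n + u) window_count S u m ^ 2 =
           \sum_(a <- S) \sum_(b <- S) w a b)%N.
  under eq_bigr => m _ do rewrite -mulnn big_distrl /=.
  rewrite exchange_big /= big_seq [RHS]big_seq; apply: eq_bigr => a aS.
  under eq_bigr => m _ do rewrite big_distrr /=.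
  rewrite exchange_big /= big_seq [RHS]big_seq; apply: eq_bigr => b bS.
  rewrite -[RHS](@sum_interval_indicator (n + u)); last first.
    by have := Sn _ aS; have := Sn _ bS; lia.
  apply: eq_bigr => m _; rewrite mulnb; congr nat_of_bool.
  by apply/idP/idP; lia.
have -> : (\sum_(a <- S) \sum_(b <- S) w a b = u * #|` S| +
   2 * \sum_(a <- S) \sum_(b <- S | a < b) (a + u - b))%N.
  have split3 a : a \in S -> (\sum_(b <- S) w a b = u +
      \sum_(b <- S | a < b) (a + u - b) + \sum_(b <- S | b < a) (b + u - a))%N.
    move=> aS; rewrite (bigD1_seq a) //= /w minnn maxnn addKn -addnA.
    congr addn; rewrite (bigID (fun b => a < b)%N) /=; congr addn.
      by apply: eq_big => b; lia.
    by apply: eq_big => b; lia.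
  rewrite big_seq (eq_bigr _ split3) -big_seq !big_split /=.
  rewrite big_const_seq count_predT iter_addn_0 mul2n -addnn addnA.
  congr (_ + _ + _)%N.
  under eq_bigr => a _ do rewrite big_mkcond.
  rewrite exchange_big /=.
  by apply: eq_bigr => a _; rewrite [RHS]big_mkcond.
have := sidon_overlaps u sS; rewrite mulnDr addnC leq_add2r.
have : (u * u.-1 <= u * u)%N by rewrite leq_mul2l leq_pred orbT.
by rewrite bin2; move: (u * u.-1)%N (u * u)%N => k l; lia.
Qed.

(** * Moments of the window counts *)

Lemma sum_window (R : realFieldType) (L a u : nat) (F : nat -> R) :
  (a + u <= L)%N ->
  \sum_(0 <= m < L) F m * (a <= m < a + u)%:R = \sum_(0 <= i < u) F (a + i)%N.
Proof.
move=> auL.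
rewrite (big_cat_nat (n := a)) //=; last lia.
rewrite (big_cat_nat (m := a) (n := (a + u)%N)) //=; last lia.
rewrite big_nat_cond big1 ?add0r; last first.
  by move=> i; rewrite andbT => hi; have -> : (a <= i < a + u)%N = false;
    [lia|rewrite mulr0].
rewrite [X in _ + X]big_nat_cond [X in _ + X]big1 ?addr0; last first.
  by move=> i; rewrite andbT => hi; have -> : (a <= i < a + u)%N = false;
    [lia|rewrite mulr0].
rewrite -{1}[a]add0n big_addn addKn.
rewrite big_nat [RHS]big_nat; apply: eq_bigr => i hi.
by rewrite addnC; have -> : (a <= a + i < a + u)%N; [lia|rewrite mulr1].
Qed.

Lemma sum_id_nat (R : realFieldType) (k : nat) :
  \sum_(0 <= i < k) i%:R = k%:R * (k%:R - 1) / 2 :> R.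
Proof.
elim: k => [|k IH]; first by rewrite big_geq // !mul0r.
by rewrite big_nat_recr //= IH -natr1; field.
Qed.

(** Nonnegativity of the sum of the [(G * f m - P * g m) ^ 2], where [P] is
    the inner product and [G] the square norm of [g], is [G] times the claim;
    if [G = 0], then [g] vanishes and both sides are [0]. *)
Lemma cauchy_schwarz (R : realFieldType) (k : nat) (f g : nat -> R) :
  (\sum_(0 <= m < k) f m * g m) ^+ 2 <=
  (\sum_(0 <= m < k) f m ^+ 2) * (\sum_(0 <= m < k) g m ^+ 2).
Proof.
set F := \sum_(0 <= m < k) f m ^+ 2; set G := \sum_(0 <= m < k) g m ^+ 2.
set P := \sum_(0 <= m < k) f m * g m.
have G0 : 0 <= G by apply: sumr_ge0 => m _; exact: sqr_ge0.
have [Gz|Gn] := eqVneq G 0.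
  have g0 m : (m < k)%N -> g m = 0.
    move=> mk; move/eqP: Gz; rewrite /G big_mkord psumr_eq0; last first.
      by move=> i _; exact: sqr_ge0.
    move/allP/(_ (Ordinal mk) (mem_index_enum _)) => /=.
    by rewrite sqrf_eq0 => /eqP.
  rewrite /P big_nat big1 ?expr0n ?Gz ?mulr0 // => m /andP[_ mk].
  by rewrite g0 // mulr0.
have expand x y : \sum_(0 <= m < k) (x * f m - y * g m) ^+ 2 =
    x ^+ 2 * F - 2 * x * y * P + y ^+ 2 * G.
  rewrite /F /P /G !mulr_sumr -sumrN -!big_split /=.
  by apply: eq_bigr => m _; ring.
have : 0 <= \sum_(0 <= m < k) (G * f m - P * g m) ^+ 2.
  by apply: sumr_ge0 => m _; exact: sqr_ge0.
have -> : \sum_(0 <= m < k) (G * f m - P * g m) ^+ 2 = G * (F * G - P ^+ 2).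
  by rewrite expand; ring.
by rewrite pmulr_rge0 ?subr_ge0 // lt_neqAle eq_sym Gn.
Qed.

Lemma window_count_sum (R : realFieldType) (S : {fset nat}) (u L : nat)
    (F : nat -> R) :
  (forall a, a \in S -> a + u <= L)%N ->
  \sum_(0 <= m < L) F m * (window_count S u m)%:R =
  \sum_(a <- S) \sum_(0 <= i < u) F (a + i)%N.
Proof.
move=> SL; under eq_bigr => m _ do rewrite natr_sum mulr_sumr.
rewrite exchange_big /= big_seq [RHS]big_seq; apply: eq_bigr => a aS.
by rewrite sum_window // SL.
Qed.

Lemma window_count_moment0 (R : realFieldType) (S : {fset nat})
    (n u : nat) : (forall a, a \in S -> a <= n)%N ->
  \sum_(0 <= m < n + u) (window_count S u m)%:R = u%:R * (#|` S|)%:R :> R.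
Proof.
move=> Sn; under eq_bigr => m _ do rewrite -[_%:R]mul1r.
rewrite (@window_count_sum _ S u (n + u) (fun=> 1)); last first.
  by move=> a /Sn; rewrite leq_add2r.
rewrite big_const_nat subn0 iter_addr_0 big_const_seq count_predT iter_addr_0.
by rewrite mulr_natr.
Qed.

(** The windows containing [a] end at [a, ..., a + u - 1], on average at
    [a + (u - 1) / 2].  Relative to the midpoint [(n + u - 1) / 2] of all
    positions this is [a - n / 2], so the centre [n / 2] comes out exactly. *)
Lemma window_count_moment1 (R : realFieldType) (S : {fset nat})
    (n u : nat) : (forall a, a \in S -> a <= n)%N ->
  \sum_(0 <= m < n + u)
     (m%:R - ((n + u)%:R - 1) / 2) * (window_count S u m)%:R =
  u%:R * (\sum_(a <- S) a%:R - 1 / 2 * n%:R * (#|` S|)%:R) :> R.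
Proof.
move=> Sn.
rewrite (@window_count_sum _ S u (n + u)
           (fun m => m%:R - ((n + u)%:R - 1) / 2));
  last by move=> a /Sn; rewrite leq_add2r.
have inner (a : nat) : \sum_(0 <= i < u) ((a + i)%:R - ((n + u)%:R - 1) / 2) =
    u%:R * (a%:R - 1 / 2 * n%:R) :> R.
  under eq_bigr => i _ do rewrite natrD addrAC addrC.
  rewrite big_split /= sum_id_nat big_const_nat subn0 iter_addr_0.
  rewrite -mulr_natl natrD.
  by field.
rewrite (eq_bigr _ (fun a _ => inner a)) -mulr_sumr big_split /=.
rewrite sumrN big_const_seq count_predT iter_addr_0.
by rewrite -(mulr_natr (1 / 2 * n%:R)).
Qed.

(** Cauchy-Schwarz for the covariance of the position [m] and the count
    [A m]: the covariance is [u * D], the spread of the positions is at most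
    [L ^ 3 / 4] and the variance of the counts is controlled by the Sidon
    property. *)
Lemma sidon_sum_deviation (R : realFieldType) (S : {fset nat})
    (n u : nat) : sidon S -> (0 < u)%N ->
  (forall a, a \in S -> a <= n)%N ->
  4 * u%:R * (\sum_(a <- S) a%:R - 1 / 2 * n%:R * (#|` S|)%:R) ^+ 2 <=
  (n%:R + u%:R) ^+ 2 *
    ((n%:R + u%:R) * (u%:R + (#|` S|)%:R) - u%:R * (#|` S|)%:R ^+ 2) :> R.
Proof.
move=> sS u0 Sn.
set L := n%:R + u%:R; set t := (#|` S|)%:R.
set D := \sum_(a <- S) _ - _.
pose A m : R := (window_count S u m)%:R.
pose c : R := (L - 1) / 2; pose mu : R := u%:R * t / L.
have u0' : 0 < u%:R :> R by rewrite ltr0n.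
have L0 : 0 < L by rewrite ltr_wpDl.
have nu : (n + u)%:R = L by rewrite natrD.
have m0 : \sum_(0 <= m < n + u) A m = u%:R * t by exact: window_count_moment0.
have m1 : \sum_(0 <= m < n + u) (m%:R - c) * A m = u%:R * D.
  by rewrite /c -nu; exact: window_count_moment1.
have m2 : \sum_(0 <= m < n + u) A m ^+ 2 <= u%:R * (u%:R + t).
  have := sidon_window_square u sS Sn.
  rewrite -(ler_nat R) natrM natrD natr_sum.
  by under eq_bigr => m _ do rewrite natrX.
have cst (x : R) : \sum_(0 <= m < n + u) x = L * x.
  by rewrite big_const_nat subn0 iter_addr_0 -nu mulr_natl.
have z1 : \sum_(0 <= m < n + u) (m%:R - c) = 0.
  by rewrite big_split /= sum_id_nat cst nu /c; field.
(* The positions are centred, so subtracting the mean count is free. *)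
have cov : \sum_(0 <= m < n + u) (m%:R - c) * (A m - mu) = u%:R * D.
  under eq_bigr => m _ do rewrite mulrBr.
  by rewrite big_split /= m1 sumrN -mulr_suml z1 mul0r subr0.
have var : \sum_(0 <= m < n + u) (A m - mu) ^+ 2 <=
    u%:R * (u%:R + t) - (u%:R * t) ^+ 2 / L.
  have -> : \sum_(0 <= m < n + u) (A m - mu) ^+ 2 =
      \sum_(0 <= m < n + u) A m ^+ 2 - 2 * mu * (u%:R * t) + L * mu ^+ 2.
    rewrite -m0 -cst mulr_sumr -sumrN -!big_split /=.
    by apply: eq_bigr => m _; ring.
  have -> : \sum_(0 <= m < n + u) A m ^+ 2 - 2 * mu * (u%:R * t) + L * mu ^+ 2 =
      \sum_(0 <= m < n + u) A m ^+ 2 - (u%:R * t) ^+ 2 / L.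
    by rewrite /mu; field; rewrite gt_eqF.
  by rewrite lerD2r.
have spread : \sum_(0 <= m < n + u) (m%:R - c) ^+ 2 <= L * (L ^+ 2 / 4).
  rewrite -cst big_nat [leRHS]big_nat; apply: ler_sum => m /andP[_ mL].
  have m0' : 0 <= m%:R :> R by [].
  have mL' : m%:R + 1 <= L by rewrite -nu natr1 ler_nat.
  rewrite /c; nra.
have := cauchy_schwarz (n + u) (fun m => m%:R - c) (fun m => A m - mu).
rewrite cov => cs.
have {}cs : (u%:R * D) ^+ 2 <=
    L * (L ^+ 2 / 4) * (u%:R * (u%:R + t) - (u%:R * t) ^+ 2 / L).
  apply: (le_trans cs); apply: ler_pM => //; apply: sumr_ge0 => m _;
    exact: sqr_ge0.
rewrite -(ler_pM2l u0').
have -> : u%:R * (4 * u%:R * D ^+ 2) = 4 * (u%:R * D) ^+ 2 by ring.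
have -> : u%:R * (L ^+ 2 * (L * (u%:R + t) - u%:R * t ^+ 2)) =
   4 * (L * (L ^+ 2 / 4) * (u%:R * (u%:R + t) - (u%:R * t) ^+ 2 / L)).
  by field; rewrite gt_eqF.
by rewrite ler_pM2l.
Qed.

(** The inequality of [sidon_sum_deviation] at the scale [n = r ^ 4],
    [u ~ r ^ 3].  It is used twice: its right-hand side being nonnegative
    yields [t <= 4 * r ^ 2], and this makes [L * t] at most
    [12 * r ^ 3 * u], which together with [u <= 2 * r ^ 3] accounts for the
    error [14 * r ^ 3]. *)
Lemma deviation_bound (R : realFieldType) (r u t D : R) :
  1 <= r -> r ^+ 3 <= u <= 2 * r ^+ 3 ->
  0 <= t ->
  4 * u * D ^+ 2 <= (r ^+ 4 + u) ^+ 2 * ((r ^+ 4 + u) * (u + t) - u * t ^+ 2) ->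
  D ^+ 2 <= 9 / 4 * r ^+ 8 * (r ^+ 4 - t ^+ 2 + 14 * r ^+ 3).
Proof.
move=> r1 /andP[ul ur] t0.
set L := r ^+ 4 + u => main.
have r0 : 0 < r by lra.
have r3 : 0 < r ^+ 3 by exact: exprn_gt0.
have r34 : r ^+ 3 <= r ^+ 4 by rewrite [r ^+ 4]exprS ler_peMl // ltW.
have u0 : 0 < u by lra.
have L0 : 0 < L by rewrite /L; lra.
have L3 : L <= 3 * r ^+ 4 by rewrite /L; lra.
have X0 : 0 <= L * (u + t) - u * t ^+ 2.
  rewrite -(@pmulr_rge0 _ (L ^+ 2)) ?exprn_gt0 //; apply: le_trans main.
  by rewrite mulr_ge0 ?sqr_ge0 // mulr_ge0 // ltW.
(* Dividing X0 by u gives t ^ 2 <= 3 * r ^ 4 + 3 * r * t, which fails as soon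
   as t > 4 * r ^ 2. *)
have t4 : t <= 4 * r ^+ 2.
  rewrite leNgt; apply/negP => tr.
  have h1 : L * (u + t) <= 3 * r ^+ 4 * (u + t) by rewrite ler_wpM2r //; lra.
  have h2 : r ^+ 4 * t <= u * (r * t).
    have -> : r ^+ 4 * t = r ^+ 3 * (r * t) by ring.
    by rewrite ler_wpM2r // mulr_ge0 // ltW.
  have h3 : u * (t ^+ 2 - 3 * r ^+ 4 - 3 * r * t) <= 0 by lra.
  have h4 : r <= r ^+ 2 by rewrite expr2 ler_peMl // ltW.
  have h5 : 0 < t ^+ 2 - 3 * r ^+ 4 - 3 * r * t.
    have -> : r ^+ 4 = r ^+ 2 * r ^+ 2 by ring.
    have r2 : 0 < r ^+ 2 by exact: exprn_gt0.
    have : r * t <= r ^+ 2 * t by rewrite ler_wpM2r.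
    set q := r ^+ 2 in h4 r2 tr *; nra.
  by move: h3; rewrite leNgt mulr_gt0.
have Y : L * (u + t) - u * t ^+ 2 <= u * (r ^+ 4 - t ^+ 2 + 14 * r ^+ 3).
  have h1 : L * t <= 12 * r ^+ 3 * u.
    have : L * t <= 3 * r ^+ 4 * (4 * r ^+ 2) by rewrite ler_pM // ltW.
    have : r ^+ 3 * r ^+ 3 <= r ^+ 3 * u by rewrite ler_wpM2l // ltW.
    have -> : 3 * r ^+ 4 * (4 * r ^+ 2) = 12 * (r ^+ 3 * r ^+ 3) by ring.
    lra.
  have h2 : u * u <= 2 * r ^+ 3 * u by rewrite ler_wpM2r // ltW.
  rewrite /L in h1 *; lra.
rewrite -(@ler_pM2l _ (4 * u)) ?mulr_gt0 //.
apply: (le_trans main).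
have -> : 4 * u * (9 / 4 * r ^+ 8 * (r ^+ 4 - t ^+ 2 + 14 * r ^+ 3)) =
  (3 * r ^+ 4) ^+ 2 * (u * (r ^+ 4 - t ^+ 2 + 14 * r ^+ 3)) by field.
apply: ler_pM => //; first exact: sqr_ge0.
by rewrite lerXn2r ?nnegrE // ltW // (lt_le_trans L0).
Qed.

(** * The two regimes *)

Theorem corollary2 (R : realType) :
  exists2 C : R, 0 < C &
    forall (n : nat) (S : {fset nat}),
      (0 < n)%N ->
      (forall a : nat, a \in S -> (1 <= a <= n)%N) ->
      sidon S ->
      let N : R := n%:R in
      let t : R := (#|` S|)%:R in
      let D : R := `| \sum_(a <- S) a%:R - 1 / 2 * N * t | in
      (N `^ (1 / 2) - N `^ (1 / 4) <= t ->
         D <= C * N `^ (11 / 8)) /\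
      (t < N `^ (1 / 2) - N `^ (1 / 4) ->
         D <= C * N `^ (5 / 4) * Num.sqrt (N `^ (1 / 2) - t)).
Proof.
exists 6 => // n S n0 Sn sS N t D.
have N1 : 1 <= N by rewrite ler1n.
have N0 : 0 <= N by lra.
pose r := N `^ (1 / 4).
(* All exponents but 11 / 8 are multiples of 1 / 4; that one is squared. *)
have powN (x : R) k : k%:R / 4 = x -> N `^ x = r ^+ k.
  by move=> <-; rewrite -powR_mulrn ?powR_ge0 // -powRrM; congr (_ `^ _); field.
have r1 : 1 <= r by rewrite -(powRr0 N) ler_powR //; lra.
have Nr : N = r ^+ 4 by rewrite -(powN 1 4%N) ?powRr1 //; field.
rewrite -/r (powN (1 / 2) 2%N) ?(powN (5 / 4) 5%N) //; [|by field..].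
have r0 : 0 < r by lra.
have r3 : 1 <= r ^+ 3 by exact: exprn_ege1.
pose u := (Num.truncn (r ^+ 3)).+1.
have ub : r ^+ 3 <= u%:R <= 2 * r ^+ 3.
  have /andP[tl tr] := Num.Theory.truncn_itv (ltW (exprn_gt0 3 r0)).
  by rewrite (ltW tr) /u -natr1; lra.
have Sn' a : a \in S -> (a <= n)%N by move/Sn/andP => [].
have D0 : 0 <= D by exact: normr_ge0.
have t0 : 0 <= t by [].
have main : D ^+ 2 <= 9 / 4 * r ^+ 8 * (r ^+ 4 - t ^+ 2 + 14 * r ^+ 3).
  apply: deviation_bound ub t0 _ => //.
  by rewrite -Nr real_normK ?num_real //; exact: sidon_sum_deviation.
clearbody D t.
have r8 : 0 < r ^+ 8 by exact: exprn_gt0.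
have r2 : 0 < r ^+ 2 by exact: exprn_gt0.
split=> [tl|tr].
  have e : (N `^ (11 / 8)) ^+ 2 = r ^+ 11.
    by rewrite -powR_mulrn ?powR_ge0 // -powRrM; apply: powN; field.
  rewrite -(@ler_pXn2r _ 2) ?nnegrE ?mulr_ge0 ?powR_ge0 // exprMn e.
  have h : r ^+ 4 - t ^+ 2 <= 2 * r ^+ 3.
    have [tge|tlt] := leP (r ^+ 2) t.
      have : r ^+ 4 <= t ^+ 2 by rewrite (exprM r 2 2) lerXn2r ?nnegrE // ltW.
      lra.
    have -> : r ^+ 4 - t ^+ 2 = (r ^+ 2 - t) * (r ^+ 2 + t) by ring.
    have -> : 2 * r ^+ 3 = r * (2 * r ^+ 2) by ring.
    by apply: ler_pM; lra.
  have -> : r ^+ 11 = r ^+ 8 * r ^+ 3 by ring.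
  have : r ^+ 8 * (r ^+ 4 - t ^+ 2) <= r ^+ 8 * (2 * r ^+ 3).
    by rewrite ler_pM2l.
  lra.
have s0 : 0 <= r ^+ 2 - t by lra.
rewrite -(@ler_pXn2r _ 2) ?nnegrE ?mulr_ge0 ?sqrtr_ge0 ?exprn_ge0 ?(ltW r0) //.
rewrite exprMn sqr_sqrtr //.
have h : r ^+ 4 - t ^+ 2 + 14 * r ^+ 3 <= 16 * r ^+ 2 * (r ^+ 2 - t).
  have -> : r ^+ 4 - t ^+ 2 + 14 * r ^+ 3 =
    (r ^+ 2 - t) * (r ^+ 2 + t) + r ^+ 2 * (14 * r) by ring.
  have h1 : (r ^+ 2 - t) * (r ^+ 2 + t) <= (r ^+ 2 - t) * (2 * r ^+ 2).
    by rewrite ler_wpM2l //; lra.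
  have h2 : r ^+ 2 * (14 * r) <= r ^+ 2 * (14 * (r ^+ 2 - t)).
    by rewrite ler_pM2l //; lra.
  lra.
have -> : (6 * r ^+ 5) ^+ 2 = 36 * (r ^+ 8 * r ^+ 2) by ring.
have : r ^+ 8 * (r ^+ 4 - t ^+ 2 + 14 * r ^+ 3) <=
       r ^+ 8 * (16 * r ^+ 2 * (r ^+ 2 - t)) by rewrite ler_pM2l.
lra.
Qed.
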